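(* Let $N,M$ be positive integers and let $\pi,\tau$ be independent random permutations uniformly distributed over $\mathcal S_N$ and $\mathcal S_M$, respectively. Let $\mathbf D=[d(i,j,k,\ell)]\in\mathbb R^{N\times M\times N\times M}$ be a (possibly random) tensor, independent of $(\pi,\tau)$, satisfying $$\sum_{i',k'\in[N]}d(i',j,k',\ell)=0\quad\text{and}\quad\sum_{j',\ell'\in[M]}d(i,j',k,\ell')=0$$ for all $i,k\in[N]$ and $j,\ell\in[M]$. Then, for any $\lambda\ge 0$, $$\mathrm E\Big\{\exp\Big(\lambda\sum_{i\in[N],\,j\in[M]}d(i,j,\pi(i),\tau(j))\Big)\Big\}\le\mathrm E\Big\{\exp\Big(12\lambda\sum_{i\in[N],\,j\in[M]}d(i,j,\pi(i),\tau(j))\,G_iG_j'\Big)\Big\},$$ where $G_1,G_2,\ldots,G_1',G_2',\ldots$ are independent standard Gaussian random variables, further independent of $(\mathbf D,\pi,\tau)$.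
   Context: $[N]=\{1,\dots,N\}$ and $\mathcal S_N$ is the group of permutations of $[N]$. The expectations are of nonnegative random variables and may be infinite. *)

(* Defs.v *)
From HB Require Import structures.
From mathcomp Require Import all_boot all_order all_algebra all_fingroup finmap.
From mathcomp Require Import all_classical all_reals all_analysis.

Set Implicit Arguments.
Unset Strict Implicit.
Unset Printing Implicit Defensive.

Import Order.TTheory GRing.Theory Num.Theory.
Import numFieldNormedType.Exports.

Local Open Scope classical_set_scope.
Local Open Scope ring_scope.

HB.instance Definition _ (X : finType) :=
  isPointed.Build (perm_type X) (perm_one X).
HB.instance Definition _ (X : finType) :=
  @isMeasurable.Build default_measure_display (perm_type X)
    discrete_measurable discrete_measurable0
    discrete_measurableC discrete_measurableU.

Section probability_notions.
Context d (T : measurableType d) (R : realType) (P : probability T R).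

Definition uniform_perm n (X : {RV P >-> 'S_n}) :=
  forall s : 'S_n, distribution P X [set s] = (n`!%:R^-1)%:E.

Definition std_gaussian (X : {RV P >-> R}) :=
  forall A : set R, measurable A -> distribution P X A = normal_prob 0 1 A.

Definition sigma_family d' (T' : measurableType d') (I : Type)
    (X : I -> {RV P >-> T'}) : set (set T) :=
  <<s \bigcup_i g_sigma_algebra_preimage (X i) >>.

Definition independent (F1 F2 : set (set T)) :=
  forall A B, F1 A -> F2 B -> P (A `&` B) = (P A * P B)%E.

Definition mutually_independent (I : choiceType) (F : I -> set (set T)) :=
  forall (J : {fset I}) (A : I -> set T), (forall j, j \in J -> F j (A j)) ->
    P (\bigcap_(j in [set` J]) A j) = (\prod_(j <- J) P (A j))%E.

Definition sum_family (X Y : nat -> {RV P >-> R}) (k : nat + nat) :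
    {RV P >-> R} :=
  match k with inl i => X i | inr j => Y j end.

End probability_notions.

Definition tensor_family d (T : measurableType d) (R : realType)
    (P : probability T R) (N M : nat)
    (D : 'I_N -> 'I_M -> 'I_N -> 'I_M -> {RV P >-> R})
    (x : 'I_N * 'I_M * 'I_N * 'I_M) : {RV P >-> R} :=
  let: (i, j, k, l) := x in D i j k l.

(* Main.v *)
(* Let S = sum_i a(i, s i) for a uniform permutation s, where the entries of the
   matrix a sum to 0, and let V = sum_i a(i, s i)^2. Composing s with the
   transposition (i j) gives S', and the sum of S - S' over all i, j is 2 N S; so
   exchangeability gives E[S e^S] <= E[W e^S] with W = 3 V + 3 E[V].
   Then e^W - e^S >= e^S (W - S) yields E[e^S] <= E[e^W] <= E[e^(6 V)], and
   e^(6 V) is the expectation of exp(sqrt 12 sum_i a(i, s i) G_i) over G.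
   The theorem follows by applying this once to pi, with tau fixed, and once to
   tau, with pi and G fixed: the constant is 12 = sqrt 12 * sqrt 12. *)

Require Import Defs.
From mathcomp Require Import all_boot all_order all_algebra all_fingroup finmap.
From mathcomp Require Import all_classical all_reals all_analysis.
From mathcomp Require Import measurable_realfun ring lra.

Set Implicit Arguments.
Unset Strict Implicit.
Unset Printing Implicit Defensive.

Import Order.TTheory GRing.Theory Num.Theory.
Import numFieldNormedType.Exports.

Local Open Scope classical_set_scope.
Local Open Scope ring_scope.

(** * A scalar inequality for the exponential *)

(** By symmetry take [z = x - y >= 0]; after factoring out [expR y] this is
    [tanh (z / 2) <= 3 z / 4]. The sharp constant is 1/2; the slack in 3/4 permits an elementary
    proof. *)
Lemma ler_subM_expR (R : realType) (x y : R) :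
  (x - y) * (expR x - expR y) <= 3 / 4 * (x - y) ^+ 2 * (expR x + expR y).
Proof.
wlog : x y / y <= x => [hw|yx].
  have [/hw//|/ltW/hw {}hw] := leP y x.
  by rewrite (_ : (x - y) * _ = (y - x) * (expR y - expR x)); nra.
have -> : x = y + (x - y) by ring.
set z := x - y; have z0 : 0 <= z by rewrite subr_ge0.
rewrite expRD addrAC subrr add0r.
suff : expR z - 1 <= 3 / 4 * z * (expR z + 1).
  by move=> h; have := expR_gt0 y; have := mulr_ge0 z0 (expR_ge0 y); nra.
have e0 := expR_gt0 z.
(* For [z >= 4 / 3] the factor [3 / 4 * z] is at least 1 and the bound is immediate. *)
have [zl|zl] := leP (4 / 3) z; first by nra.
(* [exp (- z / 2) >= 1 - z / 2] bounds [exp z] by [(1 - z / 2) ^ (-2)] *)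
have h1 : 1 - z / 2 <= expR (- (z / 2)) by rewrite expR_ge1Dx.
have h2 : expR (- (z / 2)) * expR (- (z / 2)) * expR z = 1.
  by rewrite -!expRD -[RHS]expR0; congr expR; field.
set w := expR (- (z / 2)) in h1 h2.
have h3 : (1 - z / 2) ^+ 2 * expR z <= 1.
  have u0 : 0 <= 1 - z / 2 by lra.
  rewrite -[leRHS]h2 ler_pM2r//; nra.
(* The quadratic factor of the difference has discriminant [1/4 - 3/8 < 0]. *)
have h4 : (1 - 3 / 4 * z) <= (1 + 3 / 4 * z) * (1 - z / 2) ^+ 2.
  rewrite -subr_ge0 (_ : _ - _ = z * (1/2 - z / 2 + 3 / 16 * z ^+ 2)); last by field.
  by apply: mulr_ge0 => //; nra.
have h5 : (1 - 3 / 4 * z) * expR z <= 1 + 3 / 4 * z.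
  apply: (le_trans (ler_wpM2r (ltW e0) h4)).
  rewrite -(mulrA (1 + _)) ler_piMr//; lra.
lra.
Qed.

(** * Exponential moments of permutation sums by exchangeable pairs *)

Section permutation_sums.
Context (R : realType) (n : nat).
Implicit Types (a : 'I_n -> 'I_n -> R) (s : 'S_n) (f : 'S_n -> R).

Definition perm_sum a s := \sum_i a i (s i).

(** In a product of permutations the left factor acts first, so [tperm i j * s] exchanges the values
    of [s] at [i] and [j], and only these two terms change. *)
Lemma perm_sum_swap a s i j :
  perm_sum a s - perm_sum a (tperm i j * s)%g =
  a i (s i) + a j (s j) - a i (s j) - a j (s i).
Proof.
rewrite /perm_sum; have [->|ij] := eqVneq i j.
  by rewrite tperm1 mul1g; ring.
rewrite (bigD1 i)//= (bigD1 j)/=; last by rewrite eq_sym.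
rewrite [X in _ - X](bigD1 i)//= [X in _ - (_ + X)](bigD1 j)/=; last first.
  by rewrite eq_sym.
rewrite !permM tpermL tpermR.
rewrite [X in _ - (_ + (_ + X))](eq_bigr (fun k => a k (s k))); first by ring.
by move=> k /andP[ki kj]; rewrite permM tpermD// eq_sym.
Qed.

(** The linear regression identity of the exchangeable pair. The total of [a] is kept, not assumed
    zero, so that the identity also serves for the squared entries. *)
Lemma sum_swap a s :
  \sum_i \sum_j (perm_sum a s - perm_sum a (tperm i j * s)%g) =
  2 * (n%:R * perm_sum a s - \sum_i \sum_k a i k).
Proof.
under eq_bigr do under eq_bigr do rewrite perm_sum_swap.
under eq_bigr do rewrite !big_split/= !sumrN sumr_const card_ord.
rewrite !big_split/= !sumrN -/(perm_sum a s).
rewrite sumr_const card_ord -sumrMnl.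
have E : \sum_i \sum_j a i (s j) = \sum_i \sum_k a i k.
  by apply: eq_bigr => i _; rewrite [RHS](reindex_inj (@perm_inj _ s)).
rewrite (exchange_big _ _ _ _ _ (fun i j => a j (s i))) E /=.
rewrite sumrMnl -/(perm_sum a s).
by rewrite -mulr_natl; ring.
Qed.

Lemma sum_tperm f i j : \sum_s f (tperm i j * s)%g = \sum_s f s.
Proof. by rewrite [RHS](reindex_inj (mulgI (tperm i j))). Qed.

(** This gives the mean of [perm_sum a] under the uniform law. Each swap difference sums to zero
    over the group, since left multiplication by a transposition is a bijection. *)
Lemma sum_perm_sum a :
  \sum_s (n%:R * perm_sum a s - \sum_i \sum_k a i k) = 0.
Proof.
suff : \sum_s 2 * (n%:R * perm_sum a s - \sum_i \sum_k a i k) = 0.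
  by rewrite -mulr_sumr; nra.
under eq_bigr do rewrite -sum_swap.
rewrite exchange_big big1// => i _; rewrite exchange_big big1// => j _.
by rewrite sumrB sum_tperm subrr.
Qed.

(** Exchanging [s] and [tperm i j * s] turns twice the left side into the sum of
    [(S - S') * (expR S - expR S')], to which the scalar inequality applies termwise; the same
    exchange merges the two exponentials on the right. *)
Lemma swap_expR_le a i j :
  \sum_s (perm_sum a s - perm_sum a (tperm i j * s)%g) * expR (perm_sum a s) <=
  3 / 4 * \sum_s (perm_sum a s - perm_sum a (tperm i j * s)%g) ^+ 2 *
    expR (perm_sum a s).
Proof.
pose S := perm_sum a; pose S' s := S (tperm i j * s)%g.
have S'K s : S' (tperm i j * s)%g = S s.
  by rewrite /S' mulgA tperm2 mul1g.
have h1 : \sum_s (S s - S' s) * expR (S' s) = - \sum_s (S s - S' s) * expR (S s).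
  rewrite -(sum_tperm _ i j) -sumrN; apply: eq_bigr => s _.
  by rewrite S'K -/(S' s); ring.
have h2 : \sum_s (S s - S' s) ^+ 2 * expR (S' s) =
          \sum_s (S s - S' s) ^+ 2 * expR (S s).
  by rewrite -(sum_tperm _ i j); apply: eq_bigr => s _; rewrite S'K -/(S' s); ring.
have : \sum_s (S s - S' s) * (expR (S s) - expR (S' s)) <=
       \sum_s 3 / 4 * (S s - S' s) ^+ 2 * (expR (S s) + expR (S' s)).
  by apply: ler_sum => s _; exact: ler_subM_expR.
under eq_bigr do rewrite mulrBr.
rewrite sumrB h1.
have -> : \sum_s 3 / 4 * (S s - S' s) ^+ 2 * (expR (S s) + expR (S' s)) =
    3 / 2 * \sum_s (S s - S' s) ^+ 2 * expR (S s).
  under eq_bigr do rewrite -mulrA mulrDr mulrDr.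
  by rewrite big_split/= -!mulr_sumr h2; field.
rewrite {h1 h2 S'K} -/S /S'; lra.
Qed.

Let sqr a i k := a i k ^+ 2.

(** Sum the swap inequality over all [i], [j]. The left side becomes [2 n S], and the squared
    differences cost a factor 8, whence [3 = (3 / 4) * 8 / 2]. *)
Lemma perm_sum_expR_le a : \sum_i \sum_k a i k = 0 ->
  \sum_s n%:R * perm_sum a s * expR (perm_sum a s) <=
  \sum_s 3 * (n%:R * perm_sum (sqr a) s + \sum_i \sum_k sqr a i k) *
    expR (perm_sum a s).
Proof.
move=> a0; pose S := perm_sum a.
have h : \sum_i \sum_j \sum_s (S s - S (tperm i j * s)%g) * expR (S s) <=
  \sum_i \sum_j 3 / 4 * \sum_s (S s - S (tperm i j * s)%g) ^+ 2 * expR (S s).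
  by apply: ler_sum => i _; apply: ler_sum => j _; exact: swap_expR_le.
have h1 : \sum_i \sum_j \sum_s (S s - S (tperm i j * s)%g) * expR (S s) =
    2 * \sum_s n%:R * S s * expR (S s).
  under eq_bigr do rewrite exchange_big/=.
  rewrite exchange_big/= mulr_sumr; apply: eq_bigr => s _.
  under eq_bigr do rewrite -mulr_suml.
  by rewrite -mulr_suml sum_swap a0 /S; ring.
have h2 : \sum_i \sum_j 3 / 4 *
    (\sum_s (S s - S (tperm i j * s)%g) ^+ 2 * expR (S s)) =
    3 / 4 * \sum_s (\sum_i \sum_j (S s - S (tperm i j * s)%g) ^+ 2) * expR (S s).
  under eq_bigr do rewrite -mulr_sumr exchange_big/=.
  rewrite -mulr_sumr exchange_big/=; congr (_ * _); apply: eq_bigr => s _.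
  under eq_bigr do rewrite -mulr_suml.
  by rewrite -mulr_suml.
have h3 : \sum_s (\sum_i \sum_j (S s - S (tperm i j * s)%g) ^+ 2) * expR (S s)
   <= \sum_s (8 * (n%:R * perm_sum (sqr a) s + \sum_i \sum_k sqr a i k)) *
    expR (S s).
  apply: ler_sum => s _; rewrite ler_wpM2r ?expR_ge0//.
  apply: (@le_trans _ _ (\sum_i \sum_j 4 * (sqr a i (s i) + sqr a j (s j) +
    sqr a i (s j) + sqr a j (s i)))).
    apply: ler_sum => i _; apply: ler_sum => j _.
    rewrite perm_sum_swap /sqr.
    set x := a i _; set y := a j _; set z := a i _; set t := a j _.
    (* These six squares add up to [4 (x^2 + y^2 + z^2 + t^2) - (x + y - z - t)^2]. *)
    have := sqr_ge0 (x - y); have := sqr_ge0 (x + z); have := sqr_ge0 (x + t).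
    have := sqr_ge0 (y + z); have := sqr_ge0 (y + t); have := sqr_ge0 (z - t).
    by nra.
  rewrite le_eqVlt; apply/orP; left; apply/eqP.
  under eq_bigr do rewrite -mulr_sumr !big_split/= sumr_const card_ord.
  rewrite -mulr_sumr !big_split/= -/(perm_sum (sqr a) s).
  rewrite sumr_const card_ord sumrMnl -/(perm_sum (sqr a) s).
  rewrite (exchange_big _ _ _ _ _ (fun i j => sqr a j (s i)))/=.
  have -> : \sum_i \sum_j sqr a i (s j) = \sum_i \sum_k sqr a i k.
    by apply: eq_bigr => i _; rewrite [RHS](reindex_inj (@perm_inj _ s)).
  by rewrite -mulr_natl; ring.
rewrite h1 h2 in h.
have -> : \sum_s 3 * (n%:R * perm_sum (sqr a) s + \sum_i \sum_k sqr a i k) *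
    expR (perm_sum a s) = 3 / 8 * \sum_s
    (8 * (n%:R * perm_sum (sqr a) s + \sum_i \sum_k sqr a i k)) * expR (S s).
  by rewrite mulr_sumr; apply: eq_bigr => s _; rewrite /S; field.
rewrite -/S; lra.
Qed.

Lemma perm_sum_mgf a : (0 < n)%N -> \sum_i \sum_k a i k = 0 ->
  \sum_s expR (perm_sum a s) <=
  \sum_s expR (6 * perm_sum (fun i k => a i k ^+ 2) s).
Proof.
move=> n0 a0; pose S := perm_sum a; pose V := perm_sum (sqr a).
(* [m] is the mean of [V] over all permutations, as [Vm] confirms. *)
pose m := (\sum_i \sum_k sqr a i k) / n%:R.
have nR : 0 < n%:R :> R by rewrite ltr0n.
have mE : \sum_i \sum_k sqr a i k = n%:R * m.
  by rewrite /m mulrCA divff ?mulr1// gt_eqF.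
have SW : 0 <= \sum_s (3 * V s + 3 * m - S s) * expR (S s).
  have := perm_sum_expR_le a0; rewrite -subr_ge0 -sumrB mE.
  rewrite (eq_bigr (fun s => n%:R * ((3 * V s + 3 * m - S s) * expR (S s)))).
    by rewrite -mulr_sumr pmulr_rge0.
  by move=> s _; rewrite -/V -/S; ring.
have Vm : \sum_s (V s - m) = 0.
  have := sum_perm_sum (sqr a); rewrite mE.
  under eq_bigr do rewrite -mulrBr.
  by rewrite -mulr_sumr => /eqP; rewrite mulf_eq0 gt_eqF//= => /eqP.
(* With [W = 3 V + 3 m], convexity gives [expR W - expR S >= (W - S) * expR S], and the right side
   has a nonnegative sum by [SW]. *)
apply: (@le_trans _ _ (\sum_s expR (3 * V s + 3 * m))).
  rewrite -subr_ge0 -sumrB; apply: le_trans SW _.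
  apply: ler_sum => s _; rewrite -/S.
  have -> : expR (3 * V s + 3 * m) = expR (3 * V s + 3 * m - S s) * expR (S s).
    by rewrite -expRD subrK.
  rewrite -[X in _ <= _ - X]mul1r -mulrBl.
  by rewrite ler_wpM2r ?expR_ge0// lerBrDl expR_ge1Dx.
rewrite -subr_ge0 -sumrB -/V.
(* Zero is written as a mean-zero sum so that the comparison becomes pointwise: with [x = 3 (v - m)]
   it reads [expR x * (expR x - 1) >= x]. *)
rewrite [leLHS](_ : 0 = \sum_s expR (6 * m) * (3 * (V s - m))); last first.
  by rewrite -!mulr_sumr Vm !mulr0.
apply: ler_sum => s _; set v := V s.
have -> : 6 * v = 6 * m + 3 * (v - m) + 3 * (v - m) by ring.
have -> : 3 * v + 3 * m = 6 * m + 3 * (v - m) by ring.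
set x := 3 * (v - m); rewrite !expRD -mulrA -[leRHS]mulrBr ler_wpM2l ?expR_ge0//.
have h1 := expR_ge1Dx x.
have [x0|x0] := leP 0 x; first by nra.
have : expR x * expR (- x) = 1 by rewrite -expRD subrr expR0.
have := expR_gt0 x; have := expR_ge1Dx (- x); nra.
Qed.

End permutation_sums.

(** * Integration against a measure with a density *)

Section density.
Local Open Scope ereal_scope.
Context d (T : measurableType d) (R : realType).
Variables (mu nu : {measure set T -> \bar R}) (g : T -> R).
Hypotheses (mg : measurable_fun [set: T] g) (g0 : forall x, (0 <= g x)%R).
Hypothesis nuE : forall A, measurable A -> nu A = \int[mu]_(x in A) (g x)%:E.

Import HBNNSimple.

Let integral_density_nnsfun (h : {nnsfun T >-> R}) :
  \int[nu]_x (h x)%:E = \int[mu]_x ((h x)%:E * (g x)%:E).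
Proof.
under [LHS]eq_integral do rewrite fimfunE -fsumEFin//.
rewrite [LHS]ge0_integral_fsum//; last 2 first.
  - by move=> r; exact/measurable_EFinP/measurableT_comp.
  - by move=> n x _; rewrite EFinM nnfun_muleindic_ge0.
under [RHS]eq_integral.
  move=> x xD; rewrite fimfunE -fsumEFin// ge0_mule_fsuml; last first.
    by move=> r; rewrite EFinM nnfun_muleindic_ge0.
  over.
rewrite [RHS]ge0_integral_fsum//; last 2 first.
  - move=> r; apply: emeasurable_funM; last exact/measurable_EFinP.
    exact/measurable_EFinP/measurableT_comp.
  - move=> n x _; apply: mule_ge0; last by rewrite lee_fin.
    by rewrite EFinM nnfun_muleindic_ge0.
apply: eq_fsbigr => r _.
have mr : measurable (h @^-1` [set r]) by exact: measurable_funPTI.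
rewrite integralZl_indic_nnsfun// integral_indic// setIT nuE//.
under [RHS]eq_integral do rewrite EFinM -muleA.
(* Since [h] is nonnegative, its level sets at negative [r] are empty; the remaining values meet the
   sign condition for pulling [r] out. *)
have [r0|r0] := leP 0%R r; last first.
  have -> : h @^-1` [set r] = set0.
    by rewrite -subset0 => x /= hx; move: r0; rewrite -hx ltNge fun_ge0.
  by rewrite integral_set0 mule0 integral0_eq// => x _; rewrite indic0 mul0e mule0.
rewrite ge0_integralZl//; last 2 first.
  - apply: emeasurable_funM => //; exact/measurable_EFinP.
  - by move=> x _; rewrite mule_ge0// lee_fin.
congr (_ * _); rewrite integral_mkcond; apply: eq_integral => x _.
by rewrite patchE indicE; case: ifPn; rewrite ?mul1e ?mul0e.
Qed.

(** The case of simple functions passes to the limit by monotone convergence on both sides. *)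
Lemma ge0_integral_density (f : T -> \bar R) :
  measurable_fun [set: T] f -> (forall x, 0 <= f x) ->
  \int[nu]_x f x = \int[mu]_x (f x * (g x)%:E).
Proof.
move=> mf f0; pose f_ := nnsfun_approx measurableT mf.
transitivity (lim (\int[nu]_x (f_ n x)%:E @[n --> \oo])).
  rewrite -monotone_convergence//=.
  - apply: eq_integral => ? /[!inE] xD; apply/esym/cvg_lim => //=.
    exact: cvg_nnsfun_approx.
  - by move=> n; exact/measurable_EFinP/measurable_funTS.
  - by move=> n ? _; rewrite lee_fin.
  - by move=> ? _ ? ? mn; rewrite lee_fin; exact/lefP/nd_nnsfun_approx.
under eq_fun do rewrite integral_density_nnsfun.
rewrite -monotone_convergence//=.
- apply: eq_integral => x _; apply/cvg_lim => //=.
  by apply: cvgeZr => //; exact: cvg_nnsfun_approx.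
- move=> n; apply: emeasurable_funM; last exact/measurable_EFinP.
  exact/measurable_EFinP/measurable_funTS.
- by move=> n ? _; rewrite mule_ge0// lee_fin.
- move=> x _ ? ? mn; apply: lee_wpmul2r; rewrite ?lee_fin//.
  exact/lefP/nd_nnsfun_approx.
Qed.

End density.

(** * The Gaussian moment generating function *)

Section gaussian_mgf.
Local Open Scope ereal_scope.
Context (R : realType).

(** Completing the square turns [expR (c * x)] times the standard density into [expR (c ^+ 2 / 2)]
    times the density centred at [c], which integrates to 1. *)
Lemma normal_mgf (c : R) :
  \int[normal_prob 0 1]_x (expR (c * x))%:E = (expR (c ^+ 2 / 2))%:E.
Proof.
rewrite (@ge0_integral_density _ _ _ lebesgue_measure _ (normal_pdf 0 1))//.
- transitivity (\int[lebesgue_measure]_x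
    ((expR (c ^+ 2 / 2))%:E * (normal_pdf c 1 x)%:E)); last first.
    rewrite ge0_integralZl//.
    + by rewrite integral_normal_pdf mule1.
    + by apply/measurable_EFinP; exact: measurable_normal_pdf.
    + by move=> x _; rewrite lee_fin normal_pdf_ge0.
  apply: eq_integral => x _.
  rewrite -!EFinM !normal_pdfE ?oner_neq0// /normal_fun.
  rewrite !(mulrCA _ (normal_peak _)) -!expRD; congr (_ * expR _)%:E.
  by field.
- exact: measurable_normal_pdf.
- by move=> x; exact: normal_pdf_ge0.
- by apply/measurable_EFinP; apply: measurableT_comp.
Qed.

Lemma std_gaussian_mgf d (T : measurableType d) (P : probability T R)
    (X : {RV P >-> R}) (c : R) : std_gaussian X ->
  \int[P]_w (expR (c * X w))%:E = (expR (c ^+ 2 / 2))%:E.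
Proof.
(* [normal_prob] lives on the Stieltjes copy of [R]: transport it along the
   identity to the canonical measurable structure of [R] *)
move=> XN; have mid : measurable_fun [set: measurableTypeR R]
    (fun x : measurableTypeR R => x : R).
  by move=> _ A mA; rewrite setTI.
have mf : measurable_fun [set: R] (fun x : R => (expR (c * x))%:E).
  by apply/measurable_EFinP; apply: measurableT_comp.
have f0 (x : R) : 0 <= (expR (c * x))%:E by rewrite lee_fin expR_ge0.
rewrite -normal_mgf -(ge0_integral_distribution X mf f0).
transitivity (\int[pushforward (normal_prob 0 1)
    (fun x : measurableTypeR R => x : R)]_x (expR (c * x))%:E).
  by apply: eq_measure_integral => A mA _; exact: XN.
by rewrite (ge0_integral_pushforward mid).
Qed.

End gaussian_mgf.

(** * Decoupling independent variables by Tonelli *)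

Section integral_independent.
Local Open Scope ereal_scope.
Context d d1 d2 (T : measurableType d) (T1 : measurableType d1)
  (T2 : measurableType d2) (R : realType) (P : probability T R).
Variables (X : T -> T1) (Y : T -> T2) (f : T1 * T2 -> \bar R).
Hypotheses (mX : measurable_fun [set: T] X) (mY : measurable_fun [set: T] Y).
Hypotheses (mf : measurable_fun [set: T1 * T2] f) (f0 : forall x, 0 <= f x).

Let X' : {mfun T >-> T1} := mfun_Sub (mem_set mX).
Let Y' : {mfun T >-> T2} := mfun_Sub (mem_set mY).

Let fubini_FE : fubini_F (distribution P Y') f = fun x => \int[P]_w f (x, Y w).
Proof.
apply/funext => x; rewrite /fubini_F.
by rewrite (ge0_integral_distribution Y')//; exact: measurableT_comp.
Qed.

Lemma measurable_fun_integral_snd :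
  measurable_fun [set: T1] (fun x => \int[P]_w f (x, Y w)).
Proof. by rewrite -fubini_FE; exact: measurable_fun_fubini_tonelli_F. Qed.

(** Factorization on rectangles identifies the joint law with the product of the laws. Stating the
    result with two sample points in the same space keeps product spaces out of later arguments. *)
Lemma ge0_integral_independent :
  (forall A B, measurable A -> measurable B ->
    P (X @^-1` A `&` Y @^-1` B) = P (X @^-1` A) * P (Y @^-1` B)) ->
  \int[P]_w f (X w, Y w) = \int[P]_w \int[P]_w' f (X w, Y w').
Proof.
move=> XY.
have mXY : measurable_fun [set: T] (fun w => (X w, Y w)).
  exact: measurable_fun_pair.
have E := @product_measure_unique _ _ _ _ _ (distribution P X') (distribution P Y')
  (pushforward P (fun w => (X w, Y w))) XY.
transitivity (\int[pushforward P (fun w => (X w, Y w))]_z f z).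
  by rewrite (ge0_integral_pushforward mXY)//; exact: in1W.
rewrite (@eq_measure_integral _ _ _ _
  (distribution P X' \x distribution P Y')); last first.
  by move=> A mA _; exact/esym/E.
rewrite fubini_tonelli1// fubini_FE.
by rewrite (ge0_integral_distribution X')//; [exact: measurable_fun_integral_snd|
  move=> x; exact: integral_ge0].
Qed.

End integral_independent.

(** * Independence of generated sigma-algebras and of disjoint groups *)

Section independence.
Context d (T : measurableType d) (R : realType) (P : probability T R).

(** Uniqueness of measures on a pi-system is used twice: [half] enlarges one side with the other
    fixed, and is then applied with the sides exchanged. *)
Lemma independent_sigma_algebra (C1 C2 : set (set T)) :
  C1 `<=` measurable -> C2 `<=` measurable -> setI_closed C1 -> setI_closed C2 ->
  C1 setT -> C2 setT -> independent P C1 C2 -> independent P <<s C1 >> <<s C2 >>.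
Proof.
move=> mC1 mC2 C1I C2I C1T C2T C12.
have half (D1 D2 : set (set T)) : D1 `<=` measurable -> D2 `<=` measurable ->
    setI_closed D1 -> D1 setT -> independent P D1 D2 -> independent P <<s D1 >> D2.
  move=> mD1 mD2 D1I D1T D12 A B sA DB.
  have mB := mD2 _ DB.
  have PB : (P B = (fine (P B))%:E) by rewrite fineK// fin_num_measure.
  have PB0 : (0 <= fine (P B))%R by rewrite fine_ge0.
  (* For fixed [B] these are the measures [P (A & B)] and [P A * P B] in [A]; they agree on the
     pi-system [D1]. *)
  pose m1 := mrestr P mB; pose m2 := mscale (NngNum PB0) P.
  rewrite -[LHS]/(m1 A) muleC [in RHS]PB -[RHS]/(m2 A).
  apply: (g_sigma_algebra_measure_unique D1 mD1 (fun=> setT)) => //.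
  - by rewrite bigcup_const.
  - by move=> E DE; rewrite [LHS]D12// /m2 /= /mscale /= -PB muleC.
  - by move=> _; rewrite /= /mrestr setTI ltey_eq fin_num_measure.
have h1 := half _ _ mC1 mC2 C1I C1T C12.
have m1 : <<s C1 >> `<=` measurable.
  exact: smallest_sub (@sigma_algebra_measurable _ T) mC1.
move=> A B sA sB; rewrite setIC muleC.
apply: (half C2 <<s C1 >>) => //.
by move=> ? ? ? ?; rewrite setIC muleC; exact: h1.
Qed.

Context (I : choiceType) (F : I -> set (set T)).
Hypothesis F_measurable : forall i, F i `<=` measurable.
Hypothesis F_sigma : forall i, sigma_algebra setT (F i).

(** Cylinders over finitely many indices of [J] form a pi-system. [B] is total and trivial off [K],
    so cylinders intersect index by index. *)
Let cylinder (J : set I) : set (set T) :=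
  [set A | exists (K : {fset I}) (B : I -> set T),
  [/\ [set` K] `<=` J, forall i, F i (B i), forall i, i \notin K -> B i = setT &
    A = \bigcap_i B i]].

Let FT i : F i setT.
Proof. by have [h0 hC _] := F_sigma i; rewrite -(setD0 setT); exact: hC. Qed.

Let FI i A B : F i A -> F i B -> F i (A `&` B).
Proof.
by have /sigma_algebraP[]// := F_sigma i; move=> _ _ _; exact.
Qed.

Let cylinder_measurable J : cylinder J `<=` measurable.
Proof.
move=> _ [K [B [_ FB BT ->]]].
rewrite (_ : \bigcap_i B i = \bigcap_(i in [set` K]) B i).
  by apply: fin_bigcap_measurable => // i _; exact: F_measurable.
apply/seteqP; split=> [w Bw i _|w Bw i _]; first exact: Bw.
by have [/Bw//|/BT->] := boolP (i \in K).
Qed.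

Let cylinderT J : cylinder J setT.
Proof.
exists fset0, (fun=> setT); split=> //.
by apply/seteqP; split=> // w _ i.
Qed.

Let cylinderI J : setI_closed (cylinder J).
Proof.
move=> _ _ [K [B [KJ FB BT ->]]] [K' [B' [KJ' FB' BT' ->]]].
exists (K `|` K')%fset, (fun i => B i `&` B' i); split.
- by move=> i /=; rewrite in_fsetU => /orP[/KJ|/KJ'].
- by move=> i; exact: FI.
- by move=> i; rewrite in_fsetU negb_or => /andP[/BT-> /BT'->]; rewrite setIT.
- by rewrite bigcapI.
Qed.

Let sub_cylinder J : <<s \bigcup_(j in J) F j >> `<=` <<s cylinder J >>.
Proof.
apply: sub_sigma_algebra2 => A [j Jj FA].
exists [fset j]%fset, (fun i => if i == j then A else setT); split.
- by move=> i /=; rewrite in_fset1 => /eqP->.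
- by move=> i; case: eqVneq => [->|_].
- by move=> i; rewrite in_fset1 => /negbTE->.
- apply/seteqP; split=> [w Aw i _|w /(_ j Logic.I)]; last by rewrite eqxx.
  by case: ifP.
Qed.

Hypothesis F_indep : mutually_independent P F.

(** The freedom in [L] lets cylinders with different supports be compared as products over one index
    set. *)
Let cylinder_prob (K L : {fset I}) (B : I -> set T) :
  (forall i, F i (B i)) -> (forall i, i \notin K -> B i = setT) -> (K `<=` L)%fset ->
  P (\bigcap_i B i) = (\prod_(i <- L) P (B i))%E.
Proof.
move=> FB BT /fsubsetP KL; rewrite -F_indep//; congr (P _).
apply/seteqP; split=> [w Bw i _|w Bw i _]; first exact: Bw.
have [/KL/Bw//|/BT->//] := boolP (i \in K).
Qed.

(** On cylinders, each index constrains at most one of the two events because the groups are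
    disjoint, so the product over the union of supports splits. The pi-system argument does the
    rest. *)
Lemma mutually_independent_group (J J' : set I) : J `&` J' = set0 ->
  independent P <<s \bigcup_(j in J) F j >> <<s \bigcup_(j in J') F j >>.
Proof.
move=> JJ' A B /sub_cylinder sA /sub_cylinder sB.
suff : independent P (cylinder J) (cylinder J').
  move=> CC'; apply: (independent_sigma_algebra _ _ _ _ _ _ CC' sA sB).
  - exact: cylinder_measurable.
  - exact: cylinder_measurable.
  - exact: cylinderI.
  - exact: cylinderI.
  - exact: cylinderT.
  - exact: cylinderT.
move=> _ _ [K [C [KJ FC CT ->]]] [K' [C' [KJ' FC' CT' ->]]].
pose L := (K `|` K')%fset.
rewrite (cylinder_prob FC CT (fsubsetUl K K')).
rewrite (cylinder_prob FC' CT' (fsubsetUr K K')).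
rewrite -big_split/= -bigcapI.
rewrite (@cylinder_prob L L).
- apply: eq_bigr => i _.
  have [iK|/CT->] := boolP (i \in K); last first.
    by rewrite setTI probability_setT mul1e.
  have [iK'|/CT'->] := boolP (i \in K'); last first.
    by rewrite setIT probability_setT mule1.
  by have := conj (KJ i iK) (KJ' i iK') : (J `&` J') i; rewrite JJ'.
- by move=> i; exact: FI.
- by move=> i; rewrite in_fsetU negb_or => /andP[/CT-> /CT'->]; rewrite setIT.
- exact: fsubset_refl.
Qed.

End independence.

(** * Decoupling along independent sub-sigma-algebras *)

Section sub_sigma_algebra.
Context d (T : measurableType d).

Lemma measurable_fun_g_sigma d' (T' : measurableType d') (C : set (set T))
    (X : T -> T') :
  g_sigma_algebra_preimage X `<=` <<s C >> ->
  measurable_fun [set: g_sigma_algebraType C] X.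
Proof. by move=> XC _ A mA; apply: XC; exists A. Qed.

Lemma sigma_algebra_g_preimage d' (T' : measurableType d') (X : T -> T') :
  sigma_algebra setT (g_sigma_algebra_preimage X).
Proof. exact/sigma_algebra_preimage/sigma_algebra_measurable. Qed.

Lemma g_sigma_algebra_preimage_measurable d' (T' : measurableType d')
    (X : {mfun T >-> T'}) : g_sigma_algebra_preimage X `<=` measurable.
Proof. by move=> _ [A mA <-]; rewrite setTI; exact: measurable_funPTI. Qed.

Local Open Scope ereal_scope.

(** The identity of [T], read as a map into each of the two generated sigma-algebras, provides the
    two independent variables. *)
Lemma ge0_integral_diag (R : realType) (P : probability T R)
    (C1 C2 : set (set T)) (f : T -> T -> \bar R) :
  C1 `<=` measurable -> C2 `<=` measurable ->
  independent P <<s C1 >> <<s C2 >> ->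
  measurable_fun [set: g_sigma_algebraType C1 * g_sigma_algebraType C2]
    (fun x => f x.1 x.2) ->
  (forall x y, 0 <= f x y) ->
  \int[P]_w f w w = \int[P]_w \int[P]_w' f w w'.
Proof.
move=> mC1 mC2 C12 mf f0.
have mid (C : set (set T)) : C `<=` measurable ->
    measurable_fun [set: T] (fun x : T => x : g_sigma_algebraType C).
  move=> mC _ A mA; rewrite setTI.
  exact: (smallest_sub (@sigma_algebra_measurable _ T) mC).
by rewrite -(ge0_integral_independent (mid _ mC1) (mid _ mC2) mf).
Qed.

End sub_sigma_algebra.

(** * Linear forms in independent Gaussians *)

Section gaussian_sums.
Local Open Scope ereal_scope.
Context d (T : measurableType d) (R : realType) (P : probability T R).
Context (I : choiceType) (Z : I -> {RV P >-> R}).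
Hypothesis Z_indep :
  mutually_independent P (fun x => g_sigma_algebra_preimage (Z x)).

Local Notation gen J := (\bigcup_(j in J) g_sigma_algebra_preimage (Z j)).

Let gen_measurable J : gen J `<=` measurable.
Proof. by move=> A [j _]; exact: g_sigma_algebra_preimage_measurable. Qed.

Lemma measurable_fun_gen (J : set I) j : J j ->
  measurable_fun [set: g_sigma_algebraType (gen J)] (Z j).
Proof.
move=> Jj; apply: measurable_fun_g_sigma => A ZA.
by apply: sub_sigma_algebra; exists j.
Qed.

Lemma ge0_integral_group (J J' : set I) (f : T -> T -> \bar R) :
  J `&` J' = set0 ->
  measurable_fun [set: g_sigma_algebraType (gen J) * g_sigma_algebraType (gen J')]
    (fun x => f x.1 x.2) ->
  (forall x y, 0 <= f x y) ->
  \int[P]_w f w w = \int[P]_w \int[P]_w' f w w'.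
Proof.
move=> JJ'; apply: ge0_integral_diag => //.
apply: mutually_independent_group => //.
- by move=> i; exact: g_sigma_algebra_preimage_measurable.
- by move=> i; exact: sigma_algebra_g_preimage.
Qed.

(** Induction on [n], decoupling the last variable from the earlier ones; injectivity of [e] makes
    these groups disjoint. The map [e] allows either half of a joint family to be selected. *)
Lemma gaussian_sum_mgf (e : nat -> I) (c : nat -> R) n : injective e ->
  (forall i, std_gaussian (Z (e i))) ->
  \int[P]_w (expR (\sum_(i < n) c i * Z (e i) w))%:E =
  (expR ((\sum_(i < n) c i ^+ 2) / 2))%:E.
Proof.
move=> inje ZN; elim: n => [|n IH].
  under eq_integral do rewrite big_ord0 expR0.
  by rewrite big_ord0 mul0r expR0 integral_cst// mul1e; exact: probability_setT.
under eq_integral do rewrite big_ord_recr/= expRD EFinM.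
rewrite (@ge0_integral_group [set e i | i in `I_n] [set e n]
  (fun w w' => (expR (\sum_(i < n) c i * Z (e i) w))%:E *
    (expR (c n * Z (e n) w'))%:E))%E.
- under eq_integral.
    move=> w _; rewrite ge0_integralZl//; last first.
      apply/measurable_EFinP; apply: measurableT_comp => //.
      exact: measurable_funM.
    rewrite std_gaussian_mgf//.
    over.
  rewrite ge0_integralZr//.
  + by rewrite IH big_ord_recr/= mulrDl expRD EFinM.
  + apply/measurable_EFinP; apply: measurableT_comp => //.
    by apply: measurable_sum => i; exact: measurable_funM.
- rewrite -subset0 => _ [[i /= ilt <-]] /= /inje E.
  by rewrite E ltnn in ilt.
- apply: emeasurable_funM; apply/measurable_EFinP; apply: measurableT_comp => //.
    apply: measurable_sum => i; apply: measurable_funM => //.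
    apply: (measurableT_comp (measurable_fun_gen _) measurable_fst).
    by exists i => //=.
  apply: measurable_funM => //.
  exact: (measurableT_comp (measurable_fun_gen _) measurable_snd).
- by move=> w w'; rewrite mule_ge0// lee_fin expR_ge0.
Qed.

End gaussian_sums.

(** * The inequality for a fixed tensor *)

Section double_sums.
Context (R : realType) (N M : nat).
Implicit Types (delta : 'I_N -> 'I_M -> 'I_N -> 'I_M -> R) (s : 'S_N) (t : 'S_M).

Definition double_sum delta s t := \sum_i \sum_j delta i j (s i) (t j).

Definition gaussian_double_sum delta (g g' : nat -> R) s t :=
  \sum_(i < N) \sum_(j < M) delta i j (s i) (t j) * g i * g' j.

Local Notation r12 := (Num.sqrt 12 : R).

Let r12E : r12 * r12 = 12.
Proof. by rewrite -expr2 sqr_sqrtr. Qed.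

Local Open Scope ereal_scope.

Context d (T : measurableType d) (P : probability T R).
Context (G G' : nat -> {RV P >-> R}).
Hypothesis G_gauss : forall n, std_gaussian (G n).
Hypothesis G'_gauss : forall n, std_gaussian (G' n).
Hypothesis G_indep : mutually_independent P
  (fun x => g_sigma_algebra_preimage (sum_family G G' x)).

(** Sums over all permutations stand for expectations without their normalization. Each of the two
    indices is treated by [perm_sum_mgf] followed by a Gaussian linearization of the resulting
    squares. *)
Lemma double_permutation_mgf delta (c : R) :
  (0 < N)%N -> (0 < M)%N ->
  (forall j l, \sum_i \sum_k delta i j k l = 0)%R ->
  (forall i k, \sum_j \sum_l delta i j k l = 0)%R ->
  \sum_s \sum_t (expR (c * double_sum delta s t))%:E <=
  \sum_s \sum_t \int[P]_w
    (expR (12 * c * gaussian_double_sum delta (G^~ w) (G'^~ w) s t))%:E.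
Proof.
move=> N0 M0 rows cols.
pose a s t (i : 'I_N) := (c * \sum_(j < M) delta i j (s i) (t j))%R.
pose b s w (j : 'I_M) (l : 'I_M) :=
  (r12 * c * \sum_(i < N) delta i j (s i) l * G i w)%R.
(* Coefficients are extended by 0 to all naturals, as [gaussian_sum_mgf] expects. *)
have ext n (u : 'I_n -> R) : exists v : nat -> R, forall i : 'I_n, v i = u i.
  exists (fun k => if insub k is Some i then u i else 0%R) => i.
  by rewrite valK.
have meas n (u : 'I_n -> R) (H : nat -> {RV P >-> R}) :
    measurable_fun [set: T] (fun w => (expR (\sum_(i < n) u i * H i w))%:E).
  apply/measurable_EFinP; apply: measurableT_comp => //.
  by apply: measurable_sum => i; exact: measurable_funM.
(* The coefficient [r12] is chosen because [r12 ^+ 2 / 2 = 6]. *)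
have mgf n (u : 'I_n -> R) : \int[P]_w (expR (\sum_(i < n) r12 * u i * G i w))%:E =
    (expR (6 * \sum_(i < n) u i ^+ 2))%:E.
  have [v vE] := ext n (fun i => r12 * u i)%R.
  under eq_integral do under eq_bigr do rewrite -vE.
  rewrite (gaussian_sum_mgf G_indep v n (inl_inj (B := nat)))//.
  congr (expR _)%:E; rewrite mulr_suml mulr_sumr; apply: eq_bigr => i _.
  by rewrite vE exprMn [(r12 ^+ 2)%R]expr2 r12E; field.
have mgf' n (u : 'I_n -> R) : \int[P]_w (expR (\sum_(i < n) r12 * u i * G' i w))%:E =
    (expR (6 * \sum_(i < n) u i ^+ 2))%:E.
  have [v vE] := ext n (fun i => r12 * u i)%R.
  under eq_integral do under eq_bigr do rewrite -vE.
  rewrite (gaussian_sum_mgf G_indep v n (inr_inj (A := nat)))//.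
  congr (expR _)%:E; rewrite mulr_suml mulr_sumr; apply: eq_bigr => i _.
  by rewrite vE exprMn [(r12 ^+ 2)%R]expr2 r12E; field.
(* First application, over [s] with [t] fixed; [rows] makes the matrix entries sum to zero. *)
apply: (@le_trans _ _ (\sum_s \sum_t (expR (6 * \sum_i a s t i ^+ 2))%:E)).
  rewrite exchange_big [leRHS]exchange_big/=; apply: lee_sum => t _.
  rewrite !sumEFin lee_fin.
  under eq_bigr do rewrite /double_sum mulr_sumr.
  apply: (@perm_sum_mgf R N (fun i k => c * \sum_(j < M) delta i j k (t j))%R N0).
  rewrite /=; under eq_bigr do rewrite -mulr_sumr exchange_big/=.
  rewrite -mulr_sumr exchange_big/= big1 ?mulr0// => j _; exact: rows.
(* Exchanging the sums, the linear form in [G] becomes a permutation sum in [t] for the random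
   matrix [b s w]. *)
have bE s t w : (\sum_(i < N) r12 * a s t i * G i w = \sum_j b s w j (t j))%R.
  under [RHS]eq_bigr do rewrite /b mulr_sumr.
  rewrite exchange_big/=; apply: eq_bigr => i _.
  rewrite /a mulrA mulr_sumr mulr_suml; apply: eq_bigr => j _; ring.
under eq_bigr do under eq_bigr do rewrite -mgf.
apply: lee_sum => s _.
rewrite [leLHS](_ : _ = \int[P]_w \sum_t
    (expR (\sum_(i < N) r12 * a s t i * G i w))%:E); last first.
  by rewrite ge0_integral_sum// => t; exact: meas.
have mexpb t : measurable_fun [set: T]
    (fun w => (expR (6 * \sum_j b s w j (t j) ^+ 2))%:E).
  apply/measurable_EFinP; apply: measurableT_comp => //.
  apply: measurable_funM => //.
  apply: measurable_sum => j; apply: measurable_funX; apply: measurable_funM => //.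
  by apply: measurable_sum => i; exact: measurable_funM.
(* Second application, over [t] with [s] and the sample point [w] of [G] fixed; the zero sum now
   comes from [cols]. *)
apply: (@le_trans _ _ (\int[P]_w \sum_(t : 'S_M)
    (expR (6 * \sum_j b s w j (t j) ^+ 2))%:E)).
  apply: ge0_le_integral => //=.
  - by move=> w _; apply: sume_ge0 => t _; rewrite lee_fin expR_ge0.
  - by apply: emeasurable_sum => t; exact: meas.
  - by apply: emeasurable_sum => t; exact: mexpb.
  - move=> w _; rewrite !sumEFin lee_fin.
    under eq_bigr do rewrite bE.
    apply: (@perm_sum_mgf R M (b s w) M0).
    rewrite /b; under eq_bigr do rewrite -mulr_sumr exchange_big/=.
    rewrite -mulr_sumr exchange_big/= big1 ?mulr0// => i _.
    under eq_bigr do rewrite -mulr_suml.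
    by rewrite -mulr_suml cols mul0r.
rewrite ge0_integral_sum//.
apply: lee_sum => t _.
under eq_integral do rewrite -mgf'.
(* The second linearization has introduced [G'] at its own sample point [w']; independence of the
   two families allows [w'] to be merged with [w]. *)
rewrite -(@ge0_integral_group _ _ _ _ _ _ G_indep (range inl) (range inr)
  (fun w w' => (expR (\sum_(j < M) r12 * b s w j (t j) * G' j w'))%:E)).
- rewrite le_eqVlt; apply/orP; left; apply/eqP; apply: eq_integral => w _.
  congr (expR _)%:E; rewrite /gaussian_double_sum exchange_big/= mulr_sumr.
  apply: eq_bigr => j _; rewrite /b mulrA mulrA r12E -!mulrA; congr (_ * (_ * _))%R.
  by rewrite mulr_suml.
- by rewrite -subset0 => _ [[i _ <-] [j _]].
- have mG i := @measurable_fun_gen _ _ _ _ _ (sum_family G G') _ _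
    (ex_intro2 _ _ i Logic.I erefl : range inl (inl i)).
  have mG' j := @measurable_fun_gen _ _ _ _ _ (sum_family G G') _ _
    (ex_intro2 _ _ j Logic.I erefl : range inr (inr j)).
  apply/measurable_EFinP; apply: measurableT_comp => //.
  apply: measurable_sum => j; apply: measurable_funM; last first.
    exact: (measurableT_comp (mG' j) measurable_snd).
  apply: measurable_funM => //; apply: measurable_funM => //.
  apply: measurable_sum => i; apply: measurable_funM => //.
  exact: (measurableT_comp (mG i) measurable_fst).
- by move=> w w'; rewrite lee_fin expR_ge0.
Qed.

End double_sums.

(** * Evaluation at random permutations *)

Lemma measurable_fun_perm_select n d (T : measurableType d) d'
    (T' : measurableType d') (h : T -> 'S_n) (g : 'S_n -> T -> T') :
  measurable_fun [set: T] h ->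
  (forall s, measurable_fun [set: T] (g s)) ->
  measurable_fun [set: T] (fun w => g (h w) w).
Proof.
move=> mh mg _ A mA; rewrite setTI.
rewrite (_ : _ @^-1` A =
    \bigcup_(s in [set: {perm 'I_n}]) (h @^-1` [set s] `&` g s @^-1` A)).
  apply: fin_bigcup_measurable => [|s _]; first exact: finite_finset.
  apply: measurableI.
    by rewrite -[X in measurable X]setTI; exact: mh.
  by rewrite -[X in measurable X]setTI; exact: mg.
by apply/seteqP; split=> [w gA|w [s _ [/= <-]]]//; exists (h w).
Qed.

(** The events fixing both permutations partition the space, and by independence each has
    probability [1 / (N! M!)]. *)
Lemma integral_uniform_perm_pair d (T : measurableType d) (R : realType)
    (P : probability T R) N M (X : {RV P >-> 'S_N}) (Y : {RV P >-> 'S_M})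
    (g : 'S_N -> 'S_M -> \bar R) :
  uniform_perm X -> uniform_perm Y ->
  independent P (g_sigma_algebra_preimage X) (g_sigma_algebra_preimage Y) ->
  (forall s t, 0 <= g s t)%E ->
  (\int[P]_w g (X w) (Y w) =
   \sum_s \sum_t (N`!%:R^-1 * M`!%:R^-1)%:E * g s t)%E.
Proof.
move=> XU YU XY g0; pose A s t := X @^-1` [set s] `&` Y @^-1` [set t].
have mA s t : measurable (A s t).
  by apply: measurableI; exact: measurable_funPTI.
have PA s t : P (A s t) = (N`!%:R^-1 * M`!%:R^-1)%:E.
  rewrite EFinM -(XU s) -(YU t); apply: XY.
    by exists [set s] => //; rewrite setTI.
  by exists [set t] => //; rewrite setTI.
transitivity (\int[P]_w \sum_s \sum_t (g s t * (\1_(A s t) w)%:E))%E.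
  apply: eq_integral => w _.
  rewrite (bigD1 (X w))//= (bigD1 (Y w))//= indicE mem_set// mule1.
  rewrite !big1 ?adde0// => [s sX|t tY].
    rewrite big1// => t _; rewrite indicE memNset ?mule0// => -[/= E].
    by rewrite -E eqxx in sX.
  by rewrite indicE memNset ?mule0// => -[/= _ E]; rewrite -E eqxx in tY.
have mgA s t : measurable_fun [set: T] (fun w => g s t * (\1_(A s t) w)%:E)%E.
  by apply: emeasurable_funM => //; apply/measurable_EFinP; exact: measurable_indic.
have gA0 s t w : (0 <= g s t * (\1_(A s t) w)%:E)%E.
  by rewrite mule_ge0// lee_fin.
rewrite ge0_integral_sum//; last 2 first.
- by move=> s; apply: emeasurable_sum => t.
- by move=> s w _; exact: sume_ge0.
apply: eq_bigr => s _; rewrite ge0_integral_sum//.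
apply: eq_bigr => t _; rewrite ge0_integralZl//; last first.
  by apply/measurable_EFinP; exact: measurable_indic.
by rewrite integral_indic// setIT muleC; congr (_ * _)%E; exact: PA.
Qed.

(** * Measurability of the two integrands *)

Section measurable_double_sums.
Context d1 d2 (T1 : measurableType d1) (T2 : measurableType d2) (R : realType).
Context (N M : nat) (D : 'I_N -> 'I_M -> 'I_N -> 'I_M -> T1 -> R).
Hypothesis mD : forall i j k l, measurable_fun [set: T1] (D i j k l).

Lemma measurable_expR_double_sum (c : R) (s : 'S_N) (t : 'S_M) :
  measurable_fun [set: T1]
    (fun w => (expR (c * double_sum (fun i j k l => D i j k l w) s t))%:E).
Proof.
apply/measurable_EFinP; apply: measurableT_comp => //; apply: measurable_funM => //.
by apply: measurable_sum => i; apply: measurable_sum => j.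
Qed.

(** Tensor and Gaussians live on separate spaces, to fit integrals with two sample points and any
    choice of sigma-algebras. *)
Lemma measurable_expR_gaussian_double_sum (g g' : nat -> T2 -> R) (c : R)
    (s : 'S_N) (t : 'S_M) :
  (forall i, measurable_fun [set: T2] (g i)) ->
  (forall i, measurable_fun [set: T2] (g' i)) ->
  measurable_fun [set: T1 * T2] (fun x => (expR (c * gaussian_double_sum
    (fun i j k l => D i j k l x.1) (g^~ x.2) (g'^~ x.2) s t))%:E).
Proof.
move=> mg mg'.
apply/measurable_EFinP; apply: measurableT_comp => //; apply: measurable_funM => //.
apply: measurable_sum => i; apply: measurable_sum => j.
apply: measurable_funM; last exact: measurableT_comp (mg' j) measurable_snd.
apply: measurable_funM; last exact: measurableT_comp (mg i) measurable_snd.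
exact: measurableT_comp (mD _ _ _ _) measurable_fst.
Qed.

End measurable_double_sums.

(** * Reduction of the random tensor to a fixed one *)

Theorem theorem2p2 (R : realType) (dO : measure_display)
    (Omega : measurableType dO) (P : probability Omega R)
    (N M : nat) (N_gt0 : (0 < N)%N) (M_gt0 : (0 < M)%N)
    (pi : {RV P >-> 'S_N}) (tau : {RV P >-> 'S_M})
    (pi_unif : uniform_perm pi) (tau_unif : uniform_perm tau)
    (pi_tau_indep : independent P (g_sigma_algebra_preimage pi)
                                  (g_sigma_algebra_preimage tau))
    (D : 'I_N -> 'I_M -> 'I_N -> 'I_M -> {RV P >-> R})
    (D_indep : independent P (sigma_family (tensor_family D))
       <<s g_sigma_algebra_preimage pi `|` g_sigma_algebra_preimage tau >>)
    (D_sum0 : {ae P, forall w,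
       (forall j l, \sum_(i' < N) \sum_(k' < N) D i' j k' l w = 0) /\
       (forall i k, \sum_(j' < M) \sum_(l' < M) D i j' k l' w = 0)})
    (G G' : nat -> {RV P >-> R})
    (G_gauss : forall n, std_gaussian (G n))
    (G'_gauss : forall n, std_gaussian (G' n))
    (G_mutual_indep : mutually_independent P
       (fun x => g_sigma_algebra_preimage (sum_family G G' x)))
    (G_indep : independent P (sigma_family (sum_family G G'))
       <<s sigma_family (tensor_family D) `|`
           (g_sigma_algebra_preimage pi `|` g_sigma_algebra_preimage tau) >>)
    (lambda : R) (lambda_ge0 : 0 <= lambda) :
  ('E_P[fun w => expR (lambda *
      \sum_(i < N) \sum_(j < M) D i j (pi w i) (tau w j) w)%R]
   <=
   'E_P[fun w => expR (12 * lambda *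
      \sum_(i < N) \sum_(j < M)
        D i j (pi w i) (tau w j) w * G i w * G' j w)%R])%E.
Proof.
pose sD := \bigcup_x g_sigma_algebra_preimage (tensor_family D x).
pose sG := \bigcup_x g_sigma_algebra_preimage (sum_family G G' x).
pose sP := g_sigma_algebra_preimage pi `|` g_sigma_algebra_preimage tau.
pose sDP := sigma_family (tensor_family D) `|` sP.
have msD : sD `<=` measurable.
  by move=> A [x _]; exact: g_sigma_algebra_preimage_measurable.
have msG : sG `<=` measurable.
  by move=> A [x _]; exact: g_sigma_algebra_preimage_measurable.
have msP : sP `<=` measurable.
  by move=> A [|]; exact: g_sigma_algebra_preimage_measurable.
have msDP : sDP `<=` measurable.
  move=> A [|]; last exact: msP.
  exact: (smallest_sub (@sigma_algebra_measurable _ Omega) msD).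
have D_sD i j k l : measurable_fun [set: g_sigma_algebraType sD] (D i j k l).
  apply: measurable_fun_g_sigma => A DA; apply: sub_sigma_algebra.
  by exists (i, j, k, l).
have D_sDP i j k l : measurable_fun [set: g_sigma_algebraType sDP] (D i j k l).
  apply: measurable_fun_g_sigma => A DA; apply: sub_sigma_algebra; left.
  by apply: sub_sigma_algebra; exists (i, j, k, l).
have G_sG i : measurable_fun [set: g_sigma_algebraType sG] (G i).
  by apply: measurable_fun_g_sigma => A GA; apply: sub_sigma_algebra; exists (inl i).
have G'_sG i : measurable_fun [set: g_sigma_algebraType sG] (G' i).
  by apply: measurable_fun_g_sigma => A GA; apply: sub_sigma_algebra; exists (inr i).
have pi_sP : measurable_fun [set: g_sigma_algebraType sP] pi.
  by apply: measurable_fun_g_sigma => A pA; apply: sub_sigma_algebra; left.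
have tau_sP : measurable_fun [set: g_sigma_algebraType sP] tau.
  by apply: measurable_fun_g_sigma => A pA; apply: sub_sigma_algebra; right.
have pi_sDP : measurable_fun [set: g_sigma_algebraType sDP] pi.
  by apply: measurable_fun_g_sigma => A pA; apply: sub_sigma_algebra; right; left.
have tau_sDP : measurable_fun [set: g_sigma_algebraType sDP] tau.
  by apply: measurable_fun_g_sigma => A pA; apply: sub_sigma_algebra; right; right.
(* [F] and [H] are the two integrands at fixed permutations, [H] with its own sample point [w'] for
   the Gaussians; [Psi] integrates that point out. *)
pose Dw w i j k l := D i j k l w.
pose F w s t := (expR (lambda * double_sum (Dw w) s t))%:E.
pose H w w' s t := (expR (12 * lambda *
  gaussian_double_sum (Dw w) (G^~ w') (G'^~ w') s t))%:E.
pose Psi w s t := (\int[P]_w' H w w' s t)%E.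
have F0 w s t : (0 <= F w s t)%E by rewrite lee_fin expR_ge0.
have H0 w w' s t : (0 <= H w w' s t)%E by rewrite lee_fin expR_ge0.
have Psi0 w s t : (0 <= Psi w s t)%E by exact: integral_ge0.
have mF s t : measurable_fun [set: Omega] (fun w => F w s t).
  exact: measurable_expR_double_sum.
have mF' s t : measurable_fun [set: g_sigma_algebraType sD] (fun w => F w s t).
  exact: measurable_expR_double_sum.
have mPsi s t : measurable_fun [set: Omega] (fun w => Psi w s t).
  apply: (@measurable_fun_integral_snd _ _ _ _ Omega Omega R P id
    (fun x => H x.1 x.2 s t)) => //.
  exact: (@measurable_expR_gaussian_double_sum _ _ Omega Omega R N M
    (fun i j k l w => D i j k l w) _ (fun i w => G i w) (fun i w => G' i w)).
(* Measurability with respect to the tensor alone is what permits decoupling [Psi] from the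
   permutations. *)
have mPsi' s t : measurable_fun [set: g_sigma_algebraType sD] (fun w => Psi w s t).
  apply: (@measurable_fun_integral_snd _ _ _ _ (g_sigma_algebraType sD) Omega R P id
    (fun x => H x.1 x.2 s t)) => //.
  exact: (@measurable_expR_gaussian_double_sum _ _
    (g_sigma_algebraType sD) Omega R N M
    (fun i j k l w => D i j k l w) _ (fun i w => G i w) (fun i w => G' i w)).
pose z : \bar R := (N`!%:R^-1 * M`!%:R^-1)%:E.
(* Independence of the tensor from the permutations gives the latter their own sample point, over
   which the integral is the uniform average. *)
have avg (Q : Omega -> 'S_N -> 'S_M -> \bar R) :
    (forall w s t, 0 <= Q w s t)%E ->
    (forall s t, measurable_fun [set: g_sigma_algebraType sD] (fun w => Q w s t)) ->
    (\int[P]_w Q w (pi w) (tau w) = \int[P]_w \sum_s \sum_t z * Q w s t)%E.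
  move=> Q0 mQ.
  rewrite (@ge0_integral_diag _ _ _ _ sD sP (fun w w' => Q w (pi w') (tau w')))//.
    by apply: eq_integral => w _; rewrite integral_uniform_perm_pair.
  pose T12 : measurableType _ :=
    (g_sigma_algebraType sD * g_sigma_algebraType sP)%type.
  have mpi : measurable_fun [set: T12] (fun x => pi x.2).
    exact: measurableT_comp pi_sP measurable_snd.
  have mtau : measurable_fun [set: T12] (fun x => tau x.2).
    exact: measurableT_comp tau_sP measurable_snd.
  apply: (measurable_fun_perm_select (T := T12)
    (g := fun s x => Q x.1 s (tau x.2)) mpi) => s.
  apply: (measurable_fun_perm_select (T := T12)
    (g := fun t x => Q x.1 s t) mtau) => t.
  exact: measurableT_comp (mQ s t) measurable_fst.
rewrite unlock.
have -> : (\int[P]_w (expR (lambda * \sum_(i < N) \sum_(j < M)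
    D i j (pi w i) (tau w j) w))%:E = \int[P]_w \sum_s \sum_t z * F w s t)%E.
  exact: avg.
have -> : (\int[P]_w (expR (12 * lambda * \sum_(i < N) \sum_(j < M)
    D i j (pi w i) (tau w j) w * G i w * G' j w))%:E =
    \int[P]_w \sum_s \sum_t z * Psi w s t)%E.
  (* Read backwards: the Gaussians are first separated from tensor and permutations jointly, then
     the permutations are averaged. *)
  rewrite -avg//.
  rewrite -(@ge0_integral_diag _ _ _ _ sDP sG (fun w w' => H w w' (pi w) (tau w)))//.
    by move=> A B ? ?; rewrite setIC muleC; exact: G_indep.
  pose T12 : measurableType _ :=
    (g_sigma_algebraType sDP * g_sigma_algebraType sG)%type.
  have mpi : measurable_fun [set: T12] (fun x => pi x.1).
    exact: measurableT_comp pi_sDP measurable_fst.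
  have mtau : measurable_fun [set: T12] (fun x => tau x.1).
    exact: measurableT_comp tau_sDP measurable_fst.
  apply: (measurable_fun_perm_select (T := T12)
    (g := fun s x => H x.1 x.2 s (tau x.1)) mpi) => s.
  apply: (measurable_fun_perm_select (T := T12)
    (g := fun t x => H x.1 x.2 s t) mtau) => t.
  exact: (@measurable_expR_gaussian_double_sum _ _
    (g_sigma_algebraType sDP) (g_sigma_algebraType sG) R N M
    (fun i j k l w => D i j k l w) _ (fun i w => G i w) (fun i w => G' i w)).
have z0 : (0 <= z)%E by rewrite lee_fin mulr_ge0 ?invr_ge0.
(* The zero-sum conditions hold almost everywhere, so the fixed-tensor inequality is integrated in
   its almost-everywhere form. *)
apply: ae_ge0_le_integral => //.
- by move=> w _; do 2 (apply: sume_ge0 => ? _); rewrite mule_ge0.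
- by do 2 (apply: emeasurable_sum => ?); exact: emeasurable_funM.
- by move=> w _; do 2 (apply: sume_ge0 => ? _); rewrite mule_ge0.
- by do 2 (apply: emeasurable_sum => ?); exact: emeasurable_funM.
apply: filterS D_sum0 => w [rows cols] _.
under eq_bigr do rewrite -ge0_sume_distrr//.
under [leRHS]eq_bigr do rewrite -ge0_sume_distrr//.
rewrite -!ge0_sume_distrr//; try by move=> s _; exact: sume_ge0.
by apply: lee_wpmul2l => //; exact: double_permutation_mgf.
Qed.
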